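(* Let $r \geq 1$ and let $V_1, \dots, V_r$ be finite non-empty sets. For any $\epsilon > 0$ and any function $g : V_1 \times \cdots \times V_r \to \mathbb{R}_{\geq 0}$ which is upper $\eta$-regular with $\eta \leq 2^{-40r/\epsilon^2}$, there exists $\tilde g : V_1 \times \cdots \times V_r \to [0,1]$ with complexity at most $2^{20r/\epsilon^2}$ such that $(g, \tilde g)$ is an $\epsilon$-discrepancy pair.
   Context: Put $e = \{1, \dots, r\}$, $V_f := \prod_{j \in f} V_j$ for $f \subseteq e$, $x_f := (x_j)_{j \in f}$ for $x \in V_e$, and $\partial e := \{f \subsetneq e : |f| = |e| - 1\}$. $\mathbb{E}[\,\cdot \mid x_e \in V_e]$ is the average over $V_e$ with uniform measure. For $\eta > 0$, a function $g : V_e \to \mathbb{R}_{\geq 0}$ is upper $\eta$-regular if for all subsets $B_f \subseteq V_f$, $f \in \partial e$, $$\mathbb{E}\Bigl[ (g(x_e) - 1) \prod_{f \in \partial e} 1_{B_f}(x_f) \Big| x_e \in V_e \Bigr] \leq \eta$$ (no absolute value on the left-hand side). For nonnegative functions $g, \tilde g$ on $V_e$, $(g, \tilde g)$ is an $\epsilon$-discrepancy pair if for all subsets $B_f \subseteq V_f$, $f \in \partial e$, $$\Bigl| \mathbb{E}\Bigl[ (g(x_e) - \tilde g(x_e)) \prod_{f \in \partial e} 1_{B_f}(x_f) \Big| x_e \in V_e \Bigr] \Bigr| \leq \epsilon.$$ The complexity of a function $\tilde g : V_e \to [0,1]$ is the minimum $T$ such that there is a partition of $V_e$ into $T$ sets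 $S_1, \dots, S_T$ with $\tilde g$ constant on each $S_i$, where each $S_i$ is the set of $r$-cliques of some $(r-1)$-uniform hypergraph, meaning that there exist $B_{f,i} \subseteq V_f$ for $f \in \partial e$ with $1_{S_i}(x_e) = \prod_{f \in \partial e} 1_{B_{f,i}}(x_f)$ for all $x_e \in V_e$. *)

(* Defs.v *)
From HB Require Import structures.
From mathcomp Require Import all_boot all_order all_algebra.
From mathcomp Require Import reals.
Set Implicit Arguments.
Unset Strict Implicit.
Unset Printing Implicit Defensive.
Import Order.TTheory GRing.Theory Num.Theory.
Local Open Scope ring_scope.

(* The index set e = {1, ..., r} is 'I_r, and V_e is the full product. *)
Definition Ve (r : nat) (V : 'I_r -> finType) : finType :=
  {dffun forall j : 'I_r, V j}.

Definition Vsub (r : nat) (V : 'I_r -> finType) (f : {set 'I_r}) : finType :=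
  {dffun forall j : {j : 'I_r | j \in f}, V (val j)}.

Definition proj (r : nat) (V : 'I_r -> finType) (f : {set 'I_r}) (x : Ve V) :
    Vsub V f :=
  [ffun j : {j : 'I_r | j \in f} => x (val j)].

Definition boundary (r : nat) : {set {set 'I_r}} :=
  [set f : {set 'I_r} | (f \proper [set: 'I_r]) && (#|f| == r.-1)].

Definition expect (R : realType) (T : finType) (h : T -> R) : R :=
  (\sum_(x : T) h x) / #|T|%:R.

(* A family (B_f) is given for every f, but only its members with f in the
   boundary are ever used. *)
Definition clique_ind (R : realType) (r : nat) (V : 'I_r -> finType)
    (B : forall f : {set 'I_r}, {set Vsub V f}) (x : Ve V) : R :=
  \prod_(f in boundary r) (proj f x \in B f)%:R.

Definition upper_regular (R : realType) (r : nat) (V : 'I_r -> finType)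
    (eta : R) (g : Ve V -> R) : Prop :=
  forall B : (forall f : {set 'I_r}, {set Vsub V f}),
    expect (fun x => (g x - 1) * clique_ind R B x) <= eta.

Definition discrepancy_pair (R : realType) (r : nat) (V : 'I_r -> finType)
    (eps : R) (g g' : Ve V -> R) : Prop :=
  forall B : (forall f : {set 'I_r}, {set Vsub V f}),
    `| expect (fun x => (g x - g' x) * clique_ind R B x) | <= eps.

Definition is_clique_set (R : realType) (r : nat) (V : 'I_r -> finType)
    (S : {set Ve V}) : Prop :=
  exists B : (forall f : {set 'I_r}, {set Vsub V f}),
    forall x : Ve V, (x \in S)%:R = clique_ind R B x.

Definition has_clique_partition (R : realType) (r : nat) (V : 'I_r -> finType)
    (g : Ve V -> R) (T : nat) : Prop :=
  exists P : {set {set Ve V}},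
    [/\ partition P [set: Ve V],
        #|P| = T,
        forall S, S \in P -> forall x y, x \in S -> y \in S -> g x = g y
      & forall S, S \in P -> is_clique_set R S].

(* A relation rather than a function: for r = 1 the only clique sets are the
   empty set and V_e, so a nonconstant function has no complexity. *)
Definition is_complexity (R : realType) (r : nat) (V : 'I_r -> finType)
    (g : Ve V -> R) (T : nat) : Prop :=
  has_clique_partition g T /\
  forall T' : nat, has_clique_partition g T' -> (T <= T')%N.

(* Main.v *)
Require Import Defs.
From mathcomp Require Import all_boot all_order all_algebra.
From mathcomp Require Import reals exp.
From mathcomp Require Import boolp ring lra.
Set Implicit Arguments.
Unset Strict Implicit.
Unset Printing Implicit Defensive.
Import Order.TTheory GRing.Theory Num.Theory.
Local Open Scope ring_scope.

(** The proof is an energy increment.  A colouring [s] of [V_e] whose colour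
    classes are clique sets yields the candidate [min(g_s, 1)], where [g_s] is
    the conditional average of [g] on the colour classes.  If this candidate is
    not within [eps] of [g] against some clique set [B], refine [s] by recording
    which of the [r] conditions [x_f \in B_f] hold; this multiplies the number
    of colours by [2 ^ r].

    Truncating at [1] is almost free: upper regularity, applied to each colour
    class where [g_s > 1], bounds the mean of [g_s - min(g_s, 1)] by the number
    of colours times [eta] ([expect_excess_le]).  Up to this error the truncated
    averages behave like conditional expectations of a bounded function, so by
    Pythagoras and Cauchy-Schwarz the refinement raises the mean square of the
    candidate by nearly [eps ^ 2] ([energy_increment]).

    That mean square never exceeds [1], so the refinement succeeds fewer than
    [K] times, where [K] is the integer part of [20 / eps ^ 2].  All colourings
    met on the way have at most [2 ^ (r * K)] colours, which is within the
    allowed complexity; and [2 ^ (r * K) * eta <= 2 ^ (- K) < 1 / K], which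
    makes the truncation error negligible compared with [eps ^ 2].  For
    [1 <= eps] the constant function [1] already works. *)

(** * Averages over a finite type *)

Section Expect.
Variables (R : realType) (T : finType).
Implicit Types f h : T -> R.

Lemma eq_expect f h : f =1 h -> expect f = expect h.
Proof. by move=> fh; rewrite /expect (eq_bigr h). Qed.

Lemma expectD f h : expect (fun x => f x + h x) = expect f + expect h.
Proof. by rewrite /expect big_split mulrDl. Qed.

Lemma expectZ (c : R) f : expect (fun x => c * f x) = c * expect f.
Proof. by rewrite /expect -mulr_sumr mulrA. Qed.

Lemma expectB f h : expect (fun x => f x - h x) = expect f - expect h.
Proof. by rewrite /expect sumrB mulrBl. Qed.

Lemma ler_expect f h : (forall x, f x <= h x) -> expect f <= expect h.
Proof. by move=> fh; rewrite ler_wpM2r ?invr_ge0 ?ler0n// ler_sum. Qed.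

Lemma expect_ge0 f : (forall x, 0 <= f x) -> 0 <= expect f.
Proof. by move=> f0; rewrite divr_ge0 ?sumr_ge0 ?ler0n. Qed.

Lemma expect_cst (c : R) : (0 < #|T|)%N -> expect (fun _ : T => c) = c.
Proof.
move=> T0; rewrite /expect sumr_const -(mulr_natr c) mulfK//.
by rewrite pnatr_eq0 -lt0n.
Qed.

Lemma expect_sum (I : finType) (F : I -> T -> R) :
  expect (fun x => \sum_i F i x) = \sum_i expect (F i).
Proof. by rewrite /expect exchange_big mulr_suml. Qed.

Lemma sqr_expect_le f : (0 < #|T|)%N ->
  expect f ^+ 2 <= expect (fun x => f x ^+ 2).
Proof.
move=> T0; set m := expect f.
(* The variance is nonnegative. *)
have : 0 <= expect (fun x => (f x - m) ^+ 2).
  by apply: expect_ge0 => x; rewrite sqr_ge0.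
rewrite (eq_expect (h := fun x => (f x ^+ 2 - (2 * m) * f x) + m ^+ 2)); last first.
  by move=> x; ring.
rewrite expectD expectB expectZ expect_cst// -/m; lra.
Qed.

End Expect.

(** * Conditional averages on the classes of a colouring *)

(** The conditional average is a function of the colour, not of the point, so
    that being measurable for a colouring means factoring through it.  On an
    empty class the value is [0]. *)
Definition class_avg (R : realType) (T C : finType) (s : T -> C) (g : T -> R)
    (w : C) : R :=
  (\sum_(x | s x == w) g x) / #|[pred x | s x == w]|%:R.

Definition trunc_avg (R : realType) (T C : finType) (s : T -> C) (g : T -> R)
    (x : T) : R :=
  Num.min (class_avg s g (s x)) 1.

Section Colouring.
Variables (R : realType) (T : finType) (g : T -> R).

(** The tower property: averaging over the classes is self-adjoint, and fixes
    whatever depends on the colour only. *)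
Lemma expect_class_avg (C : finType) (s : T -> C) (h : C -> R) :
  expect (fun x => h (s x) * class_avg s g (s x))
  = expect (fun x => h (s x) * g x).
Proof.
rewrite /expect; congr (_ / _).
rewrite !(partition_big s xpredT)//=; apply: eq_bigr => w _.
under eq_bigr => x /eqP -> do [].
under [RHS]eq_bigr => x /eqP -> do [].
rewrite sumr_const -[RHS]mulr_sumr -mulrnAr; congr (_ * _).
rewrite /class_avg -mulr_natr.
have [n0|n0] := eqVneq #|[pred x | s x == w]| 0%N.
  rewrite n0 invr0 !mulr0 big_pred0// => x.
  by have := card0_eq n0 x; rewrite inE.
by rewrite divfK// pnatr_eq0.
Qed.

Hypothesis g_ge0 : forall x, 0 <= g x.

Lemma class_avg_ge0 (C : finType) (s : T -> C) w : 0 <= class_avg s g w.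
Proof. by rewrite divr_ge0 ?ler0n ?sumr_ge0. Qed.

Lemma trunc_avg_ge0 (C : finType) (s : T -> C) x : 0 <= trunc_avg s g x.
Proof. by rewrite le_min ler01 class_avg_ge0. Qed.

Lemma trunc_avg_le1 (C : finType) (s : T -> C) x : trunc_avg s g x <= 1.
Proof. by rewrite ge_min lexx orbT. Qed.

Lemma trunc_avg_le (C : finType) (s : T -> C) x :
  trunc_avg s g x <= class_avg s g (s x).
Proof. by rewrite ge_min lexx. Qed.

(** A class on which the average exceeds [1] loses exactly its total excess over
    [1], which the one-sided hypothesis bounds; the other classes lose
    nothing. *)
Lemma expect_excess_le (C : finType) (s : T -> C) (eta : R) :
  0 <= eta ->
  (forall w, expect (fun x => (g x - 1) * (s x == w)%:R) <= eta) ->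
  expect (fun x => class_avg s g (s x) - trunc_avg s g x) <= #|C|%:R * eta.
Proof.
move=> eta0 reg.
rewrite (eq_expect (h := fun x => \sum_w
  (class_avg s g w - Num.min (class_avg s g w) 1) * (s x == w)%:R)); last first.
  move=> x; rewrite (bigD1 (s x))//= eqxx mulr1 big1 ?addr0// => w.
  by rewrite eq_sym => /negPf ->; rewrite mulr0.
rewrite expect_sum mulr_natl -sumr_const; apply: ler_sum => w _.
have [a1|a1] := leP (class_avg s g w) 1.
  by rewrite subrr expectZ mul0r.
apply: le_trans (reg w).
have tower := expect_class_avg s (fun v => (v == w)%:R).
rewrite (eq_expect (h := fun x =>
    (s x == w)%:R * class_avg s g (s x) - (s x == w)%:R)); last first.
  by move=> x; case: eqP => [->|_] /=; ring.
rewrite expectB tower -expectB.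
by apply: ler_expect => x; rewrite mulrBl mul1r mulrC.
Qed.

(** Here [s'] refines [s] through [p] and sees the test function [b].  Without
    truncation the two averages would be nested conditional expectations, with
    an orthogonal difference.  The truncation costs [delta] in the cross term,
    which enters twice, and once more in the correlation with [b]. *)
Lemma energy_increment (C C' : finType) (s : T -> C) (s' : T -> C')
    (p : C' -> C) (b : C' -> R) (delta eps : R) :
  (0 < #|T|)%N -> (forall x, s x = p (s' x)) ->
  (forall w, 0 <= b w <= 1) ->
  expect (fun x => class_avg s' g (s' x) - trunc_avg s' g x) <= delta ->
  delta <= eps ->
  eps <= `| expect (fun x => (g x - trunc_avg s g x) * b (s' x)) | ->
  (eps - delta) ^+ 2 - 2 * delta + expect (fun x => trunc_avg s g x ^+ 2)
    <= expect (fun x => trunc_avg s' g x ^+ 2).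
Proof.
move=> T0 sp b01 exc de disc.
pose u := trunc_avg s g; pose v := trunc_avg s' g.
pose uc w := Num.min (class_avg s g w) 1.
have uE x : u x = uc (p (s' x)) by rewrite /u /trunc_avg sp.
pose G := fun x => class_avg s g (s x).
pose G' := fun x => class_avg s' g (s' x).
have bE x : 0 <= b (s' x) <= 1 := b01 (s' x).
have cross : - delta <= expect (fun x => u x * (v x - u x)).
  have t1 : expect (fun x => u x * G x) = expect (fun x => u x * g x).
    exact: (expect_class_avg s uc).
  have t2 : expect (fun x => u x * G' x) = expect (fun x => u x * g x).
    rewrite (eq_expect (h := fun x => uc (p (s' x)) * G' x)); last first.
      by move=> x; rewrite uE.
    rewrite (expect_class_avg s' (fun w => uc (p w))).
    by apply: eq_expect => x; rewrite uE.
  have : expect (fun x => u x * G' x - u x * G x - (G' x - v x))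
      <= expect (fun x => u x * (v x - u x)).
    apply: ler_expect => x.
    have u0 : 0 <= u x by exact: trunc_avg_ge0.
    have u1 : u x <= 1 by exact: trunc_avg_le1.
    have uG : u x <= G x by exact: trunc_avg_le.
    have vG : v x <= G' x by exact: trunc_avg_le.
    nra.
  rewrite !expectB t1 t2 subrr sub0r.
  by apply: le_trans; rewrite lerN2 -expectB.
have corr : eps - delta <= `| expect (fun x => (v x - u x) * b (s' x)) |.
  have t3 : expect (fun x => (G' x - u x) * b (s' x))
          = expect (fun x => (g x - u x) * b (s' x)).
    rewrite (eq_expect (h := fun x => b (s' x) * G' x - u x * b (s' x))).
      rewrite expectB (expect_class_avg s' b) -expectB.
      by apply: eq_expect => x; ring.
    by move=> x; ring.
  have t4 : expect (fun x => (v x - u x) * b (s' x))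
     = expect (fun x => (g x - u x) * b (s' x))
       - expect (fun x => (G' x - v x) * b (s' x)).
    by rewrite -t3 -expectB; apply: eq_expect => x; ring.
  have e0 : 0 <= expect (fun x => (G' x - v x) * b (s' x)).
    apply: expect_ge0 => x; have /andP[b0 _] := bE x.
    by rewrite mulr_ge0// subr_ge0 trunc_avg_le.
  have e1 : expect (fun x => (G' x - v x) * b (s' x)) <= delta.
    apply: le_trans exc; apply: ler_expect => x; have /andP[_ b1] := bE x.
    by rewrite ler_piMr// subr_ge0 trunc_avg_le.
  rewrite t4; apply: le_trans (lerB_dist _ _).
  by rewrite (ger0_norm e0) lerB.
have sq : (eps - delta) ^+ 2 <= expect (fun x => (v x - u x) ^+ 2).
  apply: (@le_trans _ _ (expect (fun x => (v x - u x) * b (s' x)) ^+ 2)).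
    by rewrite -[leRHS]real_normK ?num_real// lerXn2r ?nnegrE ?subr_ge0.
  apply: le_trans (sqr_expect_le _ T0) _; apply: ler_expect => x.
  have /andP[b0 b1] := bE x.
  by rewrite exprMn ler_piMr ?sqr_ge0// exprn_ile1.
rewrite -/u -/v.
have -> : expect (fun x => v x ^+ 2) = expect (fun x => (v x - u x) ^+ 2)
    + 2 * expect (fun x => u x * (v x - u x)) + expect (fun x => u x ^+ 2).
  by rewrite -expectZ -!expectD; apply: eq_expect => x; ring.
lra.
Qed.

End Colouring.

(** * Colourings by clique sets *)

Lemma card_boundary r : (1 <= r)%N -> #|boundary r| = r.
Proof.
case: r => // r _.
transitivity #|[set f : {set 'I_r.+1} | #|f| == r]|.
  apply: eq_card => f; rewrite !inE properEcard subsetT cardsT card_ord /=.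
  by case: eqP => [->|]; rewrite ?ltnSn ?andbF.
by rewrite card_draws card_ord binSn.
Qed.

Section Clique.
Variables (R : realType) (r : nat) (V : 'I_r -> finType).

Lemma clique_indE (B : forall f : {set 'I_r}, {set Vsub V f}) (x : Ve V) :
  clique_ind R B x = [forall f in boundary r, proj f x \in B f]%:R.
Proof.
rewrite /clique_ind; case: forall_inP => [H|/forall_inP].
  by rewrite big1// => f /H ->.
by case/forall_inPn => f fb /negPf h; rewrite (bigD1 f)//= h mul0r.
Qed.

Lemma is_clique_setP (S : {set Ve V}) :
  is_clique_set R S <-> exists B : (forall f : {set 'I_r}, {set Vsub V f}),
    forall x, (x \in S) = [forall f in boundary r, proj f x \in B f].
Proof.
split=> -[B SB]; exists B => x; last by rewrite clique_indE SB.
by have /eqP := SB x; rewrite clique_indE eqr_nat; case: (x \in S); case: [forall _ in _, _].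
Qed.

Definition clique_colouring (C : finType) (s : Ve V -> C) :=
  forall w, is_clique_set R [set x | s x == w].

Definition signature (B : forall f : {set 'I_r}, {set Vsub V f}) (x : Ve V) :
    {ffun {f | f \in boundary r} -> bool} :=
  [ffun f => proj (val f) x \in B (val f)].

Lemma clique_ind_signature B x :
  clique_ind R B x = [forall f, signature B x f]%:R.
Proof.
rewrite clique_indE; congr (nat_of_bool _)%:R.
apply/forall_inP/forallP => [H f|H f fb]; first by rewrite ffunE H ?(valP f).
by have := H (Sub f fb); rewrite ffunE SubK.
Qed.

Lemma clique_colouring_unit : clique_colouring (fun _ : Ve V => tt).
Proof.
move=> [] /=; apply/is_clique_setP; exists (fun f => [set: Vsub V f]) => x.
by rewrite inE eqxx; apply/esym/forall_inP => f _; rewrite inE.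
Qed.

(** Each face condition and its negation constrain a single [x_f], so both can be
    absorbed into the set attached to [f]. *)
Lemma clique_colouring_refine (C : finType) (s : Ve V -> C) B :
  clique_colouring s -> clique_colouring (fun x => (s x, signature B x)).
Proof.
move=> cs [w t]; have /is_clique_setP[A AE] := cs w.
apply/is_clique_setP.
exists (fun f => A f :&: [set y | if insub f is Some f'
                               then (y \in B f) == t f' else true]) => x.
have := AE x; rewrite !inE xpair_eqE => ->.
apply/andP/forall_inP => [[/forall_inP sA /eqP tE] f fb|H].
  by rewrite inE sA// inE insubT -tE ffunE SubK eqxx.
split; first by apply/forall_inP => f /H; rewrite inE => /andP[].
apply/eqP/ffunP => f; have := H _ (valP f).
by rewrite !inE valK => /andP[_ /eqP <-]; rewrite ffunE.
Qed.

Lemma card_refined_colours (C : finType) : (1 <= r)%N ->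
  #|{: C * {ffun {f | f \in boundary r} -> bool}}| = (#|C| * 2 ^ r)%N.
Proof.
by move=> r0; rewrite card_prod card_ffun card_bool card_sig card_boundary.
Qed.

(** The nonempty colour classes form a partition into at most [#|C|] clique
    sets, and a least admissible number of parts exists. *)
Lemma complexity_le (C : finType) (s : Ve V -> C) (g : Ve V -> R) :
  clique_colouring s -> (forall x y, s x = s y -> g x = g y) ->
  exists T, is_complexity g T /\ (T <= #|C|)%N.
Proof.
move=> cs gs; pose P := preim_partition s [set: Ve V].
have PE S : S \in P -> exists w, S = [set x | s x == w].
  case/imsetP => x _ ->; exists (s x).
  by apply/setP => y; rewrite !inE eq_sym.
have hP : has_clique_partition g #|P|.
  exists P; split => //; first exact: preim_partitionP.
    move=> S /PE[w ->] x y; rewrite !inE => /eqP sx /eqP sy.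
    by apply: gs; rewrite sx sy.
  by move=> S /PE[w ->].
have leP : (#|P| <= #|C|)%N.
  apply: leq_trans (subset_leq_card (_ : P \subset
    [set [set x | s x == w] | w : C])) (leq_imset_card _ _).
  by apply/subsetP => S /PE[w ->]; apply/imset_f.
have exT : exists n, `[< has_clique_partition g n >].
  by exists #|P|; apply/asboolP.
case: (ex_minnP exT) => T /asboolP hT minT.
exists T; split; last by apply: leq_trans leP; apply/minT/asboolP.
by split=> // T' h; apply/minT/asboolP.
Qed.

End Clique.

(** * The iteration *)

Section Iteration.
Variables (R : realType) (r : nat) (V : 'I_r -> finType).
Variables (g : Ve V -> R) (eta eps : R).
Hypothesis r_gt0 : (1 <= r)%N.
Hypothesis Ve_gt0 : (0 < #|Ve V|)%N.
Hypothesis g_ge0 : forall x, 0 <= g x.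
Hypothesis eta_ge0 : 0 <= eta.
Hypothesis reg : upper_regular eta g.

Lemma clique_excess_le (C : finType) (s : Ve V -> C) :
  clique_colouring R s ->
  expect (fun x => class_avg s g (s x) - trunc_avg s g x) <= #|C|%:R * eta.
Proof.
move=> cs; apply: expect_excess_le => // w.
have [B BE] := cs w; apply: le_trans (reg B).
by apply: ler_expect => x; rewrite -BE inE.
Qed.

Lemma refine_or_done (C : finType) (s : Ve V -> C) (delta : R) :
  clique_colouring R s -> (#|C| * 2 ^ r)%:R * eta <= delta -> delta <= eps ->
  discrepancy_pair eps g (trunc_avg s g) \/
  exists (C' : finType) (s' : Ve V -> C'),
    [/\ clique_colouring R s', #|C'| = (#|C| * 2 ^ r)%N &
        (eps - delta) ^+ 2 - 2 * delta + expect (fun x => trunc_avg s g x ^+ 2)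
          <= expect (fun x => trunc_avg s' g x ^+ 2)].
Proof.
move=> cs cd de; have [|/existsNP[B /negP]] :=
  pselect (discrepancy_pair eps g (trunc_avg s g)); first by left.
rewrite -ltNge => disc; right.
have cs' := clique_colouring_refine B cs.
exists (C * {ffun {f | f \in boundary r} -> bool})%type.
exists (fun x => (s x, signature B x)); split => //.
  exact: card_refined_colours.
have := @energy_increment R (Ve V) g g_ge0 _ _ s
  (fun x => (s x, signature B x)) fst (fun w => [forall f, w.2 f]%:R) delta eps.
apply=> //.
- by move=> w; case: [forall f, _]; rewrite ?lexx ?ler01.
- by apply: le_trans (clique_excess_le cs') _; rewrite card_refined_colours.
- apply: ltW; apply: lt_le_trans disc _.
  by under eq_expect => x do rewrite clique_ind_signature.
Qed.

(** If every colouring reached before step [K] failed, the mean square would have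
    grown beyond [1] after [K] refinements. *)
Lemma exists_discrepancy_colouring (K : nat) (c delta : R) :
  (2 ^ (r * K))%:R * eta <= delta -> delta <= eps ->
  c <= (eps - delta) ^+ 2 - 2 * delta -> 1 < K%:R * c ->
  exists (C : finType) (s : Ve V -> C),
    [/\ clique_colouring R s, (#|C| <= 2 ^ (r * K))%N &
        discrepancy_pair eps g (trunc_avg s g)].
Proof.
move=> Kd de ce Kc; apply: contrapT => none.
have [C [s [_ _ energy]]] : exists (C : finType) (s : Ve V -> C),
    [/\ clique_colouring R s, #|C| = (2 ^ (r * K))%N &
        K%:R * c <= expect (fun x => trunc_avg s g x ^+ 2)].
  elim: {-2}K (leqnn K) => [_|k IH kK].
    exists unit, (fun=> tt); split; first exact: clique_colouring_unit.
      by rewrite card_unit muln0.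
    by rewrite mul0r expect_ge0// => x; rewrite sqr_ge0.
  have [C [s [cs cC en]]] := IH (ltnW kK).
  have cC' : (#|C| * 2 ^ r = 2 ^ (r * k.+1))%N by rewrite cC -expnD mulnSr.
  have cd : (#|C| * 2 ^ r)%:R * eta <= delta.
    apply: le_trans Kd; rewrite ler_wpM2r// ler_nat cC'.
    by rewrite leq_exp2l// leq_mul2l kK orbT.
  have [done|[C' [s' [cs' cE en']]]] := refine_or_done cs cd de.
    exfalso; apply: none; exists C, s; split => //.
    by rewrite cC leq_exp2l// leq_mul2l (ltnW kK) orbT.
  exists C', s'; split; rewrite ?cE//.
  by rewrite -natr1 mulrDl mul1r; lra.
have : expect (fun x => trunc_avg s g x ^+ 2) <= 1.
  rewrite -[leRHS](expect_cst 1 Ve_gt0); apply: ler_expect => x.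
  by rewrite exprn_ile1// ?trunc_avg_ge0 ?trunc_avg_le1.
lra.
Qed.

End Iteration.

(** For large [eps] no structure is needed: the upper bound is regularity
    itself, and the lower bound is [-1] because [g] is nonnegative. *)
Lemma discrepancy_pair_cst1 (R : realType) (r : nat) (V : 'I_r -> finType)
    (eps eta : R) (g : Ve V -> R) :
  (0 < #|Ve V|)%N -> (forall x, 0 <= g x) -> upper_regular eta g ->
  eta <= eps -> 1 <= eps -> discrepancy_pair eps g (fun=> 1).
Proof.
move=> V0 g0 reg ee e1 B; rewrite ler_norml (le_trans (reg B))// andbT.
apply: (@le_trans _ _ (-1)); first by rewrite lerN2.
rewrite -[leLHS](expect_cst (-1) V0); apply: ler_expect => x.
rewrite clique_indE; have := g0 x; case: [forall _ in _, _] => /=; lra.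
Qed.

Theorem theorem2p16 (R : realType) (r : nat) (hr : (1 <= r)%N)
    (V : 'I_r -> finType) (hV : forall j : 'I_r, (0 < #|V j|)%N)
    (eps : R) (heps : 0 < eps) (eta : R) (heta : 0 < eta)
    (heta_le : eta <= 2 `^ (- (40 * r%:R / eps ^+ 2)))
    (g : Ve V -> R) (hg0 : forall x, 0 <= g x) (hg : upper_regular eta g) :
  exists g' : Ve V -> R,
    [/\ forall x, 0 <= g' x <= 1,
        exists T : nat,
          is_complexity g' T /\ T%:R <= 2 `^ (20 * r%:R / eps ^+ 2)
      & discrepancy_pair eps g g'].
Proof.
have Ve0 : (0 < #|Ve V|)%N.
  by apply/card_gt0P; exists [ffun j => enum_val (Ordinal (hV j))].
pose M : R := 2 `^ (20 * r%:R / eps ^+ 2).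
have e20 : 0 < eps ^+ 2 by rewrite exprn_gt0.
have M1 : 1 <= M.
  rewrite -[leLHS](powRr0 2) ler_powR ?ler1n//.
  by rewrite divr_ge0 ?mulr_ge0 ?ler0n// ltW.
have etaM : eta * M ^+ 2 <= 1.
  have -> : M ^+ 2 = 2 `^ (40 * r%:R / eps ^+ 2).
    by rewrite expr2 -powRD ?pnatr_eq0 ?implybT//; congr (_ `^ _); field; lra.
  rewrite -ler_pdivlMr ?powR_gt0// mul1r -powRN.
  exact: heta_le.
have [e1|e1] := leP 1 eps.
  exists (fun=> 1); split=> [x||]; first by rewrite ler01 lexx.
    have [|T [cT T1]] := @complexity_le R r V _ _ (fun=> 1)
      (@clique_colouring_unit R r V); first by [].
    exists T; split => //; apply: le_trans M1.
    by rewrite lern1 -card_unit.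
  apply: (discrepancy_pair_cst1 Ve0 hg0 hg) => //.
  by rewrite (le_trans _ e1)// (le_trans _ etaM)// ler_peMr ?exprn_ege1// ltW.
have [K /andP[K1 K2]] : exists K : nat, K%:R <= 20 / eps ^+ 2 < K.+1%:R.
  exists (Num.truncn (20 / eps ^+ 2)); apply: truncn_itv.
  by rewrite divr_ge0 ?ler0n// ltW.
have KM : (2 ^ (r * K))%:R <= M.
  rewrite natrX -powR_mulrn ?ler0n// ler_powR ?ler1n//.
  by rewrite natrM -mulrA mulrCA ler_wpM2l ?ler0n.
(* [K > 20 / eps ^+ 2 - 1], and [eps < 1]. *)
have K19 : 19 < K%:R * eps ^+ 2.
  move: K2; rewrite ltr_pdivrMr// -natr1; nra.
have K2M : K%:R <= M.
  apply: le_trans KM; rewrite ler_nat.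
  by rewrite (leq_trans (ltnW (ltn_expl K (ltnSn 1))))// leq_exp2l// leq_pmull.
pose delta : R := (2 ^ (r * K))%:R * eta.
have delta19 : delta * 19 <= eps ^+ 2.
  have d1 : delta * K%:R <= 1.
    apply: le_trans etaM; rewrite /delta mulrAC mulrC expr2.
    by rewrite ler_wpM2l ?ler_pM ?ler0n// ltW.
  nra.
have delta0 : 0 <= delta by rewrite mulr_ge0 ?ler0n ?ltW.
(* [(eps - delta) ^+ 2 - 2 * delta >= eps ^+ 2 - 4 * delta], so each step gains at
   least half of [eps ^+ 2]; [K] such gains exceed [19 / 2]. *)
have [|||C [s [cs cC disc]]] := @exists_discrepancy_colouring R r V g eta eps
    hr Ve0 hg0 (ltW heta) hg K (eps ^+ 2 / 2) delta (lexx _).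
- nra.
- nra.
- nra.
exists (trunc_avg s g); split => //.
- by move=> x; rewrite trunc_avg_ge0// trunc_avg_le1.
have [|T [cT TC]] := complexity_le (g := trunc_avg s g) cs.
  by move=> x y sxy; rewrite /trunc_avg sxy.
exists T; split => //; apply: le_trans KM.
by rewrite ler_nat (leq_trans TC).
Qed.
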